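(* Let $A=\langle X,Q,\pi,\lambda\rangle$ be a finite synchronous automaton and let $\Sigma(A)$ be its associated square complex. Then $A$ is bi-reversible if and only if $\Sigma(A)$ is a VH-T-complex, i.e. if and only if the universal cover $\widetilde{\Sigma(A)}$ is a product of two trees (as a VH-complex, one tree giving the horizontal and the other the vertical direction).
   Context: **Automata.** A finite synchronous automaton $A=\langle X,Q,\pi,\lambda\rangle$ consists of finite sets $X$ (alphabet) and $Q$ (states), a transition function $\pi:X\times Q\to Q$ and an output function $\lambda:X\times Q\to X$ (also written $\pi(q,x),\lambda(q,x)$). $A$ is invertible if $\lambda(\cdot,q):X\to X$ is a permutation for every $q\in Q$; then its inverse $A^{-1}=\langle X,\overline{Q},\overline{\pi},\overline{\lambda}\rangle$ has state set $\overline{Q}=\{\overline{q}:q\in Q\}$ (a copy of $Q$), output $\overline{\lambda}(\cdot,\overline{q})=\lambda(\cdot,q)^{-1}$ and transition $\overline{\pi}(x,\overline{q})=\overline{\pi(\overline{\lambda}(x,\overline q),q)}$. The dual automaton $A^*$ has alphabet $Q$, state set $X$, transition function $\lambda$ and output function $\pi$. $A$ is bi-reversible if all eight automata $A$, $A^*$, $A^{-1}$, $(A^{-1})^*$, $(A^* )^{-1}$, $((A^* )^{-1})^*$, $((A^{-1})^* )^{-1}$, $(((A^{-1})^* )^{-1})^*$ are well defined (i.e. every inverse taken is the inverse of an invertible automaton). **Square complexes.** A square complex is built from a graph (with directed edges $e$, inverse edges $\overline{e}\neq e$) by attaching squares along closed paths of length four; each geometric square carries eight distinct directed squares permuted freely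 by the dihedral group of order 8. It is a VH-complex if its edges are partitioned into vertical and horizontal ones so that every vertex link is a bipartite graph (multiple edges allowed) with bipartition (horizontal, vertical). It is a VH-T-complex if moreover every vertex link is a complete bipartite graph (exactly one edge between any two vertices from different sides). **The complex $\Sigma(A)$.** It has one vertex $O$; its directed edges are $X^+\amalg X^-\amalg Q^+\amalg Q^-$ (disjoint copies of $X,X,Q,Q$) with $\overline{x^+}=x^-$, $\overline{q^+}=q^-$; the edges $X^\pm$ are horizontal and $Q^\pm$ vertical. There is one geometric square for each $(x,q)\in X\times Q$, attached along the closed path $x^+\,\pi(q,x)^+\,\lambda(q,x)^-\,q^-$ (bottom side $x$, right side $\pi(q,x)$, top side $\lambda(q,x)$, left side $q$). *)

(* Defs.v *)
From mathcomp Require Import all_boot all_algebra.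
From Stdlib Require Import Relations ProofIrrelevance.

Set Implicit Arguments.
Unset Strict Implicit.
Unset Printing Implicit Defensive.

(** * Automata *)

Record automaton := Automaton {
  alphabet : finType;
  state : finType;
  trans : alphabet -> state -> state;
  out : alphabet -> state -> alphabet
}.

Definition dual (A : automaton) : automaton :=
  @Automaton (state A) (alphabet A)
    (fun q x => out x q) (fun q x => trans x q).

Definition invertible (A : automaton) : Prop :=
  forall q : state A, bijective (fun x : alphabet A => out x q).

(** The copy of [state A] used as the state set of the inverse is [state A]
    itself. *)
Definition inverse (A : automaton) (hA : invertible A) : automaton :=
  let out' x q := invF (bij_inj (hA q)) x in
  @Automaton (alphabet A) (state A) (fun x q => trans (out' x q) q) out'.

Lemma invertible_dec (A : automaton) : decidable (invertible A).
Proof.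
apply: (@decP _ [forall q : state A, injectiveb (fun x => out x q)]).
apply: (iffP forallP) => [h q | h q].
  exact/injF_bij/injectiveP.
exact/injectiveP/bij_inj.
Qed.

(** [None] when [A] is not invertible, i.e. when its inverse is not defined. *)
Definition inverse_opt (A : automaton) : option automaton :=
  if invertible_dec A is left hA then Some (inverse hA) else None.

Definition bireversible (A : automaton) : Prop :=
  all isSome
    [:: Some A;
        Some (dual A);
        inverse_opt A;
        omap dual (inverse_opt A);
        inverse_opt (dual A);
        omap dual (inverse_opt (dual A));
        obind inverse_opt (omap dual (inverse_opt A));
        omap dual (obind inverse_opt (omap dual (inverse_opt A)))].

(** * Graphs, possibly infinite, with loops and multiple edges *)

Record graph := Graph {
  vertex : Type;
  edge : Type;
  org : edge -> vertex;
  einv : edge -> edge;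
  einvK : forall e, einv (einv e) = e;
  einv_neq : forall e, einv e <> e
}.

Definition ter (G : graph) (e : edge G) : vertex G := org (einv e).

Fixpoint walk (G : graph) (v : vertex G) (p : seq (edge G)) (w : vertex G) :
    Prop :=
  if p is e :: p' then org e = v /\ walk (ter e) p' w else v = w.

Definition connected (G : graph) : Prop :=
  inhabited (vertex G) /\ forall v w : vertex G, exists p, walk v p w.

Definition reduced (G : graph) (p : seq (edge G)) : Prop :=
  forall p1 e p2, p <> p1 ++ [:: e; einv e] ++ p2.

(** A single vertex is a tree. *)
Definition tree (G : graph) : Prop :=
  connected G /\
  forall (v : vertex G) (p : seq (edge G)), walk v p v -> reduced p -> p = [::].

Definition bipartite (G : graph) (P : vertex G -> bool) : Prop :=
  forall e : edge G, P (org e) = ~~ P (ter e).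

(** Geometric edges between [a] and [b], for [a <> b], correspond to directed
    edges from [a] to [b]. *)
Definition complete_bipartite (G : graph) (P : vertex G -> bool) : Prop :=
  bipartite P /\
  forall a b : vertex G, P a -> ~~ P b ->
    exists! e : edge G, org e = a /\ ter e = b.

(** * Square complexes *)

(** [dsquare] is the type of directed squares.  A directed square with boundary
    path e0 e1 e2 e3 has [side] e0; the generators of the dihedral group send it
    to the directed squares with boundary paths
      [rot]  : e1 e2 e3 e0,
      [flip] : ~e0 ~e3 ~e2 ~e1       (~e standing for the inverse edge). *)
Record square_complex := SquareComplex {
  skeleton :> graph;
  dsquare : Type;
  side : dsquare -> edge skeleton;
  rot : dsquare -> dsquare;
  flip : dsquare -> dsquare;
  rot4 : forall s, iter 4 rot s = s;
  flipK : forall s, flip (flip s) = s;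
  rot_flip_rot : forall s, rot (flip (rot s)) = flip s;
  rot_free : forall s k, 0 < k < 4 -> iter k rot s <> s;
  flip_free : forall s k, flip (iter k rot s) <> s;
  side_rot : forall s, org (side (rot s)) = ter (side s);
  side_flip : forall s, side (flip s) = einv (side s)
}.

Definition boundary (K : square_complex) (s : dsquare K) : seq (edge K) :=
  [seq side (iter k (@rot K) s) | k <- iota 0 4].

(** ** Links *)

Section Link.
Variables (K : square_complex) (v : vertex K).

Definition link_vertex := {e : edge K | org e = v}.

(** The corner of e0 e1 e2 e3 at the origin of e0 is a directed link edge from
    e0 to ~e3; it is reversed by passing to ~e3 ~e2 ~e1 ~e0. *)
Definition link_edge := {s : dsquare K | org (side s) = v}.

Definition link_org (s : link_edge) : link_vertex :=
  exist _ (side (proj1_sig s)) (proj2_sig s).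

Fact link_einv_subproof (s : link_edge) :
  org (side (rot (flip (proj1_sig s)))) = v.
Proof.
by case: s => s /= <-; rewrite side_rot side_flip /ter einvK.
Qed.

Definition link_einv (s : link_edge) : link_edge :=
  exist _ (rot (flip (proj1_sig s))) (link_einv_subproof s).

Fact link_einvK (s : link_edge) : link_einv (link_einv s) = s.
Proof.
case: s => s hs; apply: subset_eq_compat => /=.
by rewrite rot_flip_rot flipK.
Qed.

Fact link_einv_neq (s : link_edge) : link_einv s <> s.
Proof.
case: s => s hs /(f_equal (@proj1_sig _ _)) /= h.
by apply: (@flip_free K (flip s) 1) => /=; rewrite h.
Qed.

Definition link : graph := Graph link_org link_einvK link_einv_neq.

End Link.

(** ** VH-complexes *)

Definition link_horizontal (K : square_complex) (h : edge K -> bool)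
    (v : vertex K) : vertex (link v) -> bool :=
  fun e => h (proj1_sig e).

Record VH_complex := VHComplex {
  squares :> square_complex;
  horizontal : edge squares -> bool;
  horizontal_einv : forall e, horizontal (einv e) = horizontal e;
  horizontal_link : forall v, bipartite (@link_horizontal _ horizontal v)
}.

Definition VHT_complex (K : VH_complex) : Prop :=
  forall v : vertex K, complete_bipartite (@link_horizontal K (@horizontal K) v).

(** ** Morphisms and coverings *)

Record morphism (K L : square_complex) := Morphism {
  fv : vertex K -> vertex L;
  fe : edge K -> edge L;
  fs : dsquare K -> dsquare L;
  fe_org : forall e, org (fe e) = fv (org e);
  fe_einv : forall e, fe (einv e) = einv (fe e);
  fs_side : forall s, side (fs s) = fe (side s);
  fs_rot : forall s, fs (rot s) = rot (fs s);
  fs_flip : forall s, fs (flip s) = flip (fs s)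
}.

Definition preserves_VH (K L : VH_complex) (f : morphism K L) : Prop :=
  forall e : edge K, horizontal (fe f e) = horizontal e.

Definition VH_isomorphic (K L : VH_complex) : Prop :=
  exists f : morphism K L,
    [/\ preserves_VH f, bijective (fv f), bijective (fe f) & bijective (fs f)].

(** The last two conditions say that [f] maps the link of each vertex [v]
    isomorphically onto the link of [fv f v]. *)
Definition covering (K L : square_complex) (f : morphism K L) : Prop :=
  [/\ forall w : vertex L, exists v : vertex K, fv f v = w,
      forall (v : vertex K) (e' : edge L), org e' = fv f v ->
        exists! e : edge K, org e = v /\ fe f e = e'
    & forall (v : vertex K) (s' : dsquare L), org (side s') = fv f v ->
        exists! s : dsquare K, org (side s) = v /\ fs f s = s'].

Inductive elementary_homotopy (K : square_complex) (v w : vertex K) :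
    seq (edge K) -> seq (edge K) -> Prop :=
| Backtrack p1 e p2 of walk v (p1 ++ p2) w
    & walk v (p1 ++ [:: e; einv e] ++ p2) w :
    elementary_homotopy v w (p1 ++ [:: e; einv e] ++ p2) (p1 ++ p2)
| AroundSquare p1 s p2 of walk v (p1 ++ p2) w
    & walk v (p1 ++ boundary s ++ p2) w :
    elementary_homotopy v w (p1 ++ boundary s ++ p2) (p1 ++ p2).

Definition homotopic (K : square_complex) (v w : vertex K) :
    seq (edge K) -> seq (edge K) -> Prop :=
  clos_refl_sym_trans _ (elementary_homotopy v w).

Definition simply_connected (K : square_complex) : Prop :=
  connected K /\
  forall (v : vertex K) (p : seq (edge K)),
    walk v p v -> homotopic v v p [::].

(** A covering of a VH-complex carries exactly one VH-structure preserved by the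
    covering map, so restricting to VH-complexes [U] is no loss. *)
Definition universal_covering (U K : VH_complex) (f : morphism U K) : Prop :=
  [/\ covering f, preserves_VH f & simply_connected U].

(** ** The product of two graphs *)

Section Product.
Variables G H : graph.

Definition prod_edge : Type := edge G * vertex H + vertex G * edge H.

Definition prod_org (d : prod_edge) : vertex G * vertex H :=
  match d with
  | inl (e, w) => (org e, w)
  | inr (v, f) => (v, org f)
  end.

Definition prod_einv (d : prod_edge) : prod_edge :=
  match d with
  | inl (e, w) => inl (einv e, w)
  | inr (v, f) => inr (v, einv f)
  end.

Fact prod_einvK d : prod_einv (prod_einv d) = d.
Proof. by case: d => [[e w]|[v f]] /=; rewrite einvK. Qed.

Fact prod_einv_neq d : prod_einv d <> d.
Proof. by case: d => [[e w]|[v f]] /= []; apply: einv_neq. Qed.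

Definition prod_skeleton : graph := Graph prod_org prod_einvK prod_einv_neq.

(** The directed squares on e x f starting at the corner (org e, org f): [inl]
    starts along e, [inr] starts along f. *)
Definition prod_square : Type := edge G * edge H + edge G * edge H.

Definition prod_side (s : prod_square) : edge prod_skeleton :=
  match s with
  | inl (e, f) => inl (e, org f)
  | inr (e, f) => inr (org e, f)
  end.

Definition prod_rot (s : prod_square) : prod_square :=
  match s with
  | inl (e, f) => inr (einv e, f)
  | inr (e, f) => inl (e, einv f)
  end.

Definition prod_flip (s : prod_square) : prod_square :=
  match s with
  | inl (e, f) => inl (einv e, f)
  | inr (e, f) => inr (e, einv f)
  end.

Fact prod_rot4 s : iter 4 prod_rot s = s.
Proof. by case: s => [] [e f] /=; rewrite !einvK. Qed.

Fact prod_flipK s : prod_flip (prod_flip s) = s.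
Proof. by case: s => [] [e f] /=; rewrite !einvK. Qed.

Fact prod_rot_flip_rot s : prod_rot (prod_flip (prod_rot s)) = prod_flip s.
Proof. by case: s => [] [e f] /=; rewrite !einvK. Qed.

Fact prod_rot_free s k : 0 < k < 4 -> iter k prod_rot s <> s.
Proof.
by case: s => [] [e f]; case: k => [|[|[|[|k]]]] //= _ [] *;
  eapply einv_neq; eassumption.
Qed.

Fact prod_flip_free s k : prod_flip (iter k prod_rot s) <> s.
Proof.
rewrite (divn_eq k 4) addnC iterD.
have -> : iter (k %/ 4 * 4) prod_rot s = s.
  by elim: (k %/ 4) => // n IHn; rewrite mulSn iterD IHn prod_rot4.
case: (k %% 4) (ltn_pmod k (isT : 0 < 4)) => [|[|[|[|j]]]] //= _;
  by case: s => [] [e f] //= []; rewrite ?einvK => *;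
    eapply einv_neq; eassumption.
Qed.

Fact prod_side_rot s :
  org (prod_side (prod_rot s)) = ter (prod_side s).
Proof. by case: s => [] [e f]. Qed.

Fact prod_side_flip s : prod_side (prod_flip s) = einv (prod_side s).
Proof. by case: s => [] [e f]. Qed.

Definition prod_squares : square_complex :=
  SquareComplex prod_rot4 prod_flipK prod_rot_flip_rot prod_rot_free
    prod_flip_free prod_side_rot prod_side_flip.

Definition prod_horizontal (d : edge prod_squares) : bool :=
  if d is inl _ then true else false.

Fact prod_horizontal_einv d : prod_horizontal (einv d) = prod_horizontal d.
Proof. by case: d => [[e w]|[v f]]. Qed.

Fact prod_horizontal_link v : bipartite (@link_horizontal _ prod_horizontal v).
Proof. by case=> -[] [e f] hs. Qed.

Definition product : VH_complex :=
  VHComplex prod_horizontal_einv prod_horizontal_link.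

End Product.

Definition product_of_trees (U : VH_complex) : Prop :=
  exists T1 T2 : graph, [/\ tree T1, tree T2 & VH_isomorphic U (product T1 T2)].

(** The universal cover is only determined up to isomorphism: it exists, and
    each of its models is a product of two trees. *)
Definition universal_cover_is_product_of_trees (K : VH_complex) : Prop :=
  (exists (U : VH_complex) (f : morphism U K), universal_covering f) /\
  (forall (U : VH_complex) (f : morphism U K),
     universal_covering f -> product_of_trees U).

(** * The square complex of an automaton *)

Section Sigma.
Variable A : automaton.
Local Open Scope ring_scope.
Import GRing.Theory.

(** x^+ = [inl (x, true)], x^- = [inl (x, false)], and likewise with [inr] for
    the states. *)
Definition sigma_edge : Type := alphabet A * bool + state A * bool.

Definition sigma_einv (e : sigma_edge) : sigma_edge :=
  match e with
  | inl (x, b) => inl (x, ~~ b)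
  | inr (q, b) => inr (q, ~~ b)
  end.

Fact sigma_einvK e : sigma_einv (sigma_einv e) = e.
Proof. by case: e => [] [x []]. Qed.

Fact sigma_einv_neq e : sigma_einv e <> e.
Proof. by case: e => [] [x []]. Qed.

Definition sigma_skeleton : graph :=
  @Graph unit sigma_edge (fun=> tt) sigma_einv sigma_einvK sigma_einv_neq.

Definition sigma_boundary (x : alphabet A) (q : state A) :
    4.-tuple sigma_edge :=
  [tuple inl (x, true); inr (trans x q, true);
         inl (out x q, false); inr (q, false)].

(** [(x, q, i, b)] is the image under [rot ^ i \o flip ^ b] of the directed
    square at (x, q) with boundary [sigma_boundary x q]. *)
Definition sigma_square : Type := alphabet A * state A * 'Z_4 * bool.

Definition sigma_side (s : sigma_square) : edge sigma_skeleton :=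
  let: (x, q, i, b) := s in
  if b then sigma_einv (tnth (sigma_boundary x q) (- i))
  else tnth (sigma_boundary x q) i.

Definition sigma_rot (s : sigma_square) : sigma_square :=
  let: (x, q, i, b) := s in (x, q, i + 1, b).

Definition sigma_flip (s : sigma_square) : sigma_square :=
  let: (x, q, i, b) := s in (x, q, - i, ~~ b).

Fact iter_sigma_rot x q i b k :
  iter k sigma_rot (x, q, i, b) = (x, q, i + k%:R, b).
Proof.
elim: k => [|k IHk]; first by rewrite addr0.
by rewrite iterS IHk /= -addrA natr1.
Qed.

Fact sigma_rot4 s : iter 4 sigma_rot s = s.
Proof.
case: s => [[[x q] i] b]; rewrite iter_sigma_rot.
by rewrite pchar_Zp ?addr0.
Qed.

Fact sigma_flipK s : sigma_flip (sigma_flip s) = s.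
Proof. by case: s => [[[x q] i] b] /=; rewrite opprK negbK. Qed.

Fact sigma_rot_flip_rot s : sigma_rot (sigma_flip (sigma_rot s)) = sigma_flip s.
Proof. by case: s => [[[x q] i] b] /=; rewrite opprD subrK. Qed.

Fact sigma_rot_free s k : (0 < k < 4)%N -> iter k sigma_rot s <> s.
Proof.
case: s => [[[x q] i] b]; rewrite iter_sigma_rot => hk [] /eqP.
rewrite -subr_eq0 addrAC subrr add0r.
by case: k hk => [|[|[|[|k]]]] //=.
Qed.

Fact sigma_flip_free s k : sigma_flip (iter k sigma_rot s) <> s.
Proof. by case: s => [[[x q] i] b]; rewrite iter_sigma_rot; case: b => -[]. Qed.

Fact sigma_side_rot s : org (sigma_side (sigma_rot s)) = ter (sigma_side s).
Proof. by []. Qed.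

Fact sigma_side_flip s : sigma_side (sigma_flip s) = einv (sigma_side s).
Proof.
by case: s => [[[x q] i] []] /=; rewrite ?opprK ?sigma_einvK.
Qed.

Definition sigma_squares : square_complex :=
  SquareComplex sigma_rot4 sigma_flipK sigma_rot_flip_rot sigma_rot_free
    sigma_flip_free sigma_side_rot sigma_side_flip.

Definition sigma_horizontal (e : edge sigma_squares) : bool :=
  if e is inl _ then true else false.

Fact sigma_horizontal_einv e : sigma_horizontal (einv e) = sigma_horizontal e.
Proof. by case: e => [] []. Qed.

Fact sigma_horizontal_link v :
  bipartite (@link_horizontal _ sigma_horizontal v).
Proof.
by case=> -[[[x q] [[|[|[|[|i]]]] hi]] []] hs.
Qed.

Definition Sigma : VH_complex :=
  VHComplex sigma_horizontal_einv sigma_horizontal_link.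

End Sigma.

(* Main.v *)
(** Each square of [Sigma A] has four corners, and the link of the vertex is
    complete bipartite iff each of the four maps sending the square at (x, q)
    to the pair of labels meeting at a given corner is a bijection of X x Q.
    One of these maps is the identity; the injectivity of the other three is
    the invertibility of A, of its dual, and of the dual of its inverse.

    If [Sigma A] is a VH-T-complex, a horizontal letter a and a vertical letter
    b bound a unique square; let [phi b a] and [psi a b] be the sides opposite
    to a and b.  Filling in squares from the axes labels the product of the
    Cayley trees of the free groups on X and Q, and the labelling is a covering
    of [Sigma A].  A product of trees is simply connected, so by uniqueness of
    the universal covering (path lifting) every universal cover is this
    product.  Conversely, links in a product of graphs are complete bipartite,
    and coverings preserve links. *)

From mathcomp Require Import all_boot all_algebra.
From Stdlib Require Import Relations ProofIrrelevance Classical.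
From Stdlib Require Import IndefiniteDescription.
Require Import Defs.

Set Implicit Arguments.
Unset Strict Implicit.
Unset Printing Implicit Defensive.

(** * Walks *)

Section Walks.
Variable G : graph.
Implicit Types (v w x : vertex G) (e : edge G) (p q : seq (edge G)).

Lemma ter_einv e : ter (einv e) = org e.
Proof. by rewrite /ter einvK. Qed.

Lemma walk_cat v p q w :
  walk v (p ++ q) w <-> exists x, walk v p x /\ walk x q w.
Proof.
elim: p v => [|e p IHp] v /=; first by split=> [|[x [->]]//]; exists v.
split=> [[he /IHp [x [hp hq]]]|[x [[he hp] hq]]]; first by exists x.
by split=> //; apply/IHp; exists x.
Qed.

Lemma walk_end_unique v p w x : walk v p w -> walk v p x -> w = x.
Proof. by elim: p v => [|e p IHp] v /= => [<-|[_ h] [_]]; last exact: IHp. Qed.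

Lemma walk_rev v p w : walk v p w -> walk w (rev [seq einv e | e <- p]) v.
Proof.
elim: p v => [|e p IHp] v //= [<- /IHp hp].
rewrite rev_cons -cats1; apply/walk_cat; exists (ter e); split=> //=.
by rewrite ter_einv.
Qed.

End Walks.

Section MorphismWalks.
Variables (K L : square_complex) (f : morphism K L).

Lemma fe_ter e : ter (fe f e) = fv f (ter e).
Proof. by rewrite /ter -fe_einv fe_org. Qed.

Lemma walk_map v p w : walk v p w -> walk (fv f v) (map (fe f) p) (fv f w).
Proof.
elim: p v => [|e p IHp] v /= => [->//|[<- /IHp]].
by rewrite fe_org fe_ter.
Qed.

Lemma boundary_map (s : dsquare K) :
  map (fe f) (boundary s) = boundary (fs f s).
Proof. by rewrite /boundary /= -!fs_rot !fs_side. Qed.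

End MorphismWalks.

Lemma walk_boundary (K : square_complex) (s : dsquare K) :
  walk (org (side s)) (boundary s) (org (side s)).
Proof.
rewrite /boundary /=; split=> //; rewrite -!side_rot; do 3!split=> //.
exact: (f_equal (fun s => org (side s)) (rot4 s)).
Qed.

Lemma org_side_rot_flip (K : square_complex) (s : dsquare K) :
  org (side (rot (flip s))) = org (side s).
Proof. by rewrite side_rot side_flip ter_einv. Qed.

(** * Complete bipartite links *)

Definition corner_unique (K : square_complex) (e f : edge K) :=
  exists! s : dsquare K, side s = e /\ side (rot (flip s)) = f.

(** Bipartite links are built into a VH-complex, so only the unique corners remain; stating them on
    edges avoids the dependent types of link vertices. *)
Lemma VHT_complexP (K : VH_complex) :
  VHT_complex K <->
  forall e f : edge K, horizontal e -> ~~ horizontal f -> org e = org f ->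
    corner_unique e f.
Proof.
split=> [hK e f he hf hef | hK v].
  have [_ /(_ (exist _ e hef) (exist _ f erefl) he hf)] := hK (org f).
  case=> -[s hs] [[/(f_equal (@proj1_sig _ _)) /= se]].
  move=> /(f_equal (@proj1_sig _ _)) /= sf uniq_s.
  exists s; split=> // t [te tf].
  have ht : org (side t) = org f by rewrite te.
  apply: (f_equal (@proj1_sig _ _) (uniq_s (exist _ t ht) _)).
  by split; apply: subset_eq_compat.
split=> [|[e he] [f hf] /= he' hf']; first exact: horizontal_link.
have [|s [[se sf] uniq_s]] := hK e f he' hf'; first by rewrite he hf.
have hs : org (side s) = v by rewrite se.
exists (exist _ s hs); split; first by split; apply: subset_eq_compat.
case=> t ht [/(f_equal (@proj1_sig _ _)) /= te].
move=> /(f_equal (@proj1_sig _ _)) /= tf.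
exact/subset_eq_compat/uniq_s.
Qed.

(** A corner of [K] lifts to [U], and the square found there is pushed down. A competing square is
    lifted to the same vertex, where its sides must be the lifted edges. *)
Lemma covering_VHT_base (U K : VH_complex) (f : morphism U K) :
  covering f -> preserves_VH f -> VHT_complex U -> VHT_complex K.
Proof.
case=> fv_surj fe_lift fs_lift f_VH /VHT_complexP hU.
apply/VHT_complexP => e g he hg heg.
have [v hv] := fv_surj (org e).
have [e1 [[oe1 fe1] uniq_e]] := fe_lift v e (esym hv).
have [g1 [[og1 fg1] uniq_g]] : exists! g1, org g1 = v /\ fe f g1 = g.
  by apply: fe_lift; rewrite -heg.
have [|||s [[se sg] uniq_s]] := hU e1 g1.
- by rewrite -f_VH fe1.
- by rewrite -f_VH fg1.
- by rewrite oe1.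
exists (fs f s); split; first by rewrite -fs_flip -fs_rot !fs_side se sg.
move=> t' [te tg].
have [|t [[ot ft] _]] := fs_lift v t'; first by rewrite te.
rewrite -ft; congr (fs f _); apply: uniq_s; split; apply: esym.
  by apply: uniq_e; rewrite -fs_side ft.
apply: uniq_g; split; first by rewrite org_side_rot_flip.
by rewrite -fs_side fs_rot fs_flip ft.
Qed.

Lemma bijective_covering (K L : square_complex) (f : morphism K L) :
  bijective (fv f) -> bijective (fe f) -> bijective (fs f) -> covering f.
Proof.
move=> [gv fvK gvK] [ge feK geK] [gs fsK gsK].
split=> [w|v e' he|v s' hs]; first by exists (gv w).
  exists (ge e'); split=> [|e [_ <-]]; last exact: feK.
  by split=> //; apply: (can_inj fvK); rewrite -fe_org geK.
exists (gs s'); split=> [|s [_ <-]]; last exact: fsK.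
by split=> //; apply: (can_inj fvK); rewrite -fe_org -fs_side gsK.
Qed.

Lemma product_VHT (G H : graph) : VHT_complex (product G H).
Proof.
apply/VHT_complexP => -[[e w]|//] [//|[v f]] _ _ /= [<- ->].
exists (inl (e, f)); split=> [|[] [e1 f1] [] //= [-> _] [_ ->] //].
by rewrite /= einvK.
Qed.

(** * Lifting *)

Section Lifting.
Variables (P K : square_complex) (g : morphism P K).
Hypothesis g_cov : covering g.

Definition lift_end (v : vertex P) (q : seq (edge K)) (w : vertex P) :=
  exists p, walk v p w /\ map (fe g) p = q.

Lemma covering_edge_inj (e1 e2 : edge P) :
  org e1 = org e2 -> fe g e1 = fe g e2 -> e1 = e2.
Proof.
move=> ho he; have [_ lift _] := g_cov.
have [|e [_ uniq_e]] := lift (org e2) (fe g e2); first exact: fe_org.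
by rewrite -(uniq_e e1) // -(uniq_e e2).
Qed.

Lemma covering_square_inj (s1 s2 : dsquare P) :
  org (side s1) = org (side s2) -> fs g s1 = fs g s2 -> s1 = s2.
Proof.
move=> ho hs; have [_ _ lift] := g_cov.
have [|s [_ uniq_s]] := lift (org (side s2)) (fs g s2).
  by rewrite fs_side fe_org.
by rewrite -(uniq_s s1) // -(uniq_s s2).
Qed.

Lemma lift_end_exists v q k : walk (fv g v) q k -> exists w, lift_end v q w.
Proof.
elim: q v => [|e q IHq] v /=; first by exists v, [::].
case=> he hq; have [_ lift _] := g_cov.
have [e1 [[oe fe1] _]] := lift v e he.
have [|w [p [hp pq]]] := IHq (ter e1); first by rewrite -fe_ter fe1.
by exists w, (e1 :: p); rewrite /= fe1 pq.
Qed.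

Lemma lift_end_unique v q w x : lift_end v q w -> lift_end v q x -> w = x.
Proof.
case=> p [hp <-] [p' [hp' pp']]; elim: p v hp p' hp' pp' => [|e p IHp] v /=.
  by move=> <- [|//] /=.
move=> [oe hp] [|e' p'] //= [oe' hp'] [he hpp].
have ee : e' = e by apply: covering_edge_inj; rewrite ?oe.
by apply: (IHp _ hp p' _ hpp); rewrite -ee.
Qed.

Lemma lift_end_cat v q r w :
  lift_end v (q ++ r) w <-> exists x, lift_end v q x /\ lift_end x r w.
Proof.
split=> [[p [hp pqr]]|[x [[p [hp <-]] [p' [hp' <-]]]]].
  move: hp; rewrite -(cat_take_drop (size q) p) => /walk_cat [x [h1 h2]].
  exists x; split; [exists (take (size q) p)|exists (drop (size q) p)].
    by rewrite map_take pqr take_size_cat.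
  by rewrite map_drop pqr drop_size_cat.
by exists (p ++ p'); rewrite map_cat; split=> //; apply/walk_cat; exists x.
Qed.

Lemma lift_end_rev v q w :
  lift_end v q w -> lift_end w (rev [seq einv e | e <- q]) v.
Proof.
case=> p [/walk_rev hp <-]; exists (rev [seq einv e | e <- p]); split=> //.
by rewrite map_rev -!map_comp; congr (rev _); apply: eq_map => e /=;
  rewrite fe_einv.
Qed.

Lemma lift_end_backtrack v e w : lift_end v [:: e; einv e] w -> v = w.
Proof.
case=> -[|e1 [|e2 [|? ?]]] [] //= [oe1 [oe2 te2]] [fe1 fe2].
have ee : e2 = einv e1.
  by apply: covering_edge_inj; rewrite ?oe2 // fe_einv fe1.
by rewrite -te2 ee ter_einv.
Qed.

(** The lift of the square [s] at [v] has a closed boundary, and lifts of paths are unique. *)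
Lemma lift_end_boundary v s w : lift_end v (boundary s) w -> v = w.
Proof.
move=> h; have [p [hp ps]] := h.
have hs : org (side s) = fv g v.
  by case: p hp ps => //= e p [<- _] [<- _]; rewrite fe_org.
have [_ _ lift] := g_cov; have [s1 [[os1 fs1] _]] := lift v s hs.
apply: lift_end_unique _ h; exists (boundary s1); rewrite boundary_map fs1.
by split=> //; rewrite -os1; apply: walk_boundary.
Qed.

Variables (U : square_complex) (f : morphism U K).

(** A backtrack or a square boundary lifts to a closed path, so removing it does not move the
    endpoint of the lift. *)
Lemma lift_end_homotopic v u u' p p' : fv g v = fv f u ->
  homotopic u u' p p' ->
  forall w, lift_end v (map (fe f) p) w <-> lift_end v (map (fe f) p') w.
Proof.
move=> hv; elim=> [q r hqr|q|q r _ IH|q r s _ IH1 _ IH2] w //.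
(* Passing from the longer path to the shorter one suffices: the longer path has a lift, and
   endpoints are unique. *)
- suff sub: forall x, lift_end v (map (fe f) q) x ->
              lift_end v (map (fe f) r) x.
    split; first exact: sub; move=> hw.
    have [x hx] : exists x, lift_end v (map (fe f) q) x.
      have hq : walk u q u' by case: hqr.
      by apply: (@lift_end_exists _ _ (fv f u')); rewrite hv; apply: walk_map.
    by rewrite (lift_end_unique hw (sub x hx)).
  case: hqr => [q1 e q2 _ _|q1 s q2 _ _] x; rewrite !map_cat.
    rewrite /= fe_einv => /lift_end_cat [y [h1]].
    rewrite -cat1s -[_ :: map _ q2]cat1s catA.
    move=> /lift_end_cat [z [/lift_end_backtrack <- h2]].
    by apply/lift_end_cat; exists y.
  move=> /lift_end_cat [y [h1 /lift_end_cat [z [hyz h2]]]].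
  move: hyz; rewrite boundary_map => /lift_end_boundary hyz.
  by apply/lift_end_cat; exists y; split=> //; rewrite hyz.
- by rewrite IH.
- by rewrite IH1 IH2.
Qed.

Hypothesis U_sc : simply_connected U.

(** A vertex [u] goes to the endpoint of the lift of any path from [u0] to [u]; simple connectedness
    makes this independent of the path. Edges and squares are lifted at the image of their origin,
    and unique lifting yields the compatibilities. *)
Lemma lift_exists (u0 : vertex U) (v0 : vertex P) : fv g v0 = fv f u0 ->
  exists h : morphism U P,
    [/\ fv h u0 = v0, forall u, fv g (fv h u) = fv f u,
        forall e, fe g (fe h e) = fe f e & forall s, fs g (fs h s) = fs f s].
Proof.
move=> h0; have [[_ U_conn] U_loop] := U_sc.
pose R u w := exists p, walk u0 p u /\ lift_end v0 (map (fe f) p) w.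
(* The loop along [p] and back along [q] is null-homotopic, so its lift closes up at [v0]; its
   second half, reversed, lifts the image of [q] and ends where the lift for [p] does. *)
have R_fun u w x : R u w -> R u x -> w = x.
  case=> p [hp hw] [q [hq hx]].
  have pq : walk u0 (p ++ rev [seq einv e | e <- q]) u0.
    by apply/walk_cat; exists u; split=> //; apply: walk_rev.
  have [_ hback] := lift_end_homotopic h0 (U_loop _ _ pq) v0.
  have /hback : lift_end v0 [::] v0 by exists [::].
  rewrite map_cat => /lift_end_cat [y [hy]].
  rewrite -(lift_end_unique hw hy) => /lift_end_rev.
  rewrite !map_rev revK -!map_comp.
  rewrite (@eq_map _ _ _ (fe f)) => [hx'|e /=].
    exact: lift_end_unique hx' hx.
  by rewrite fe_einv einvK.
have R_tot u : exists w, R u w.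
  have [p hp] := U_conn u0 u.
  have [|w hw] := @lift_end_exists v0 (map (fe f) p) (fv f u).
    by rewrite h0; apply: walk_map.
  by exists w, p.
have [hv hvP] := functional_choice _ R_tot.
have [g_surj g_edge g_square] := g_cov.
have g_hv u : fv g (hv u) = fv f u.
  have [p [hp [q [hq qp]]]] := hvP u.
  have := walk_map g hq; rewrite qp h0 => h1.
  exact: walk_end_unique h1 (walk_map f hp).
have he_ex e : exists e', org e' = hv (org e) /\ fe g e' = fe f e.
  have [|e' [h _]] := g_edge (hv (org e)) (fe f e); last by exists e'.
  by rewrite g_hv fe_org.
have [he heP] := functional_choice _ he_ex.
have hs_ex s : exists s', org (side s') = hv (org (side s)) /\ fs g s' = fs f s.
  have [|s' [h _]] := g_square (hv (org (side s))) (fs f s); last by exists s'.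
  by rewrite g_hv fs_side fe_org.
have [hs hsP] := functional_choice _ hs_ex.
(* A path to the origin of [e], extended by [e], computes the image of [ter e]. *)
have he_ter e : ter (he e) = hv (ter e).
  have [oe fe1] := heP e; have [p [hp hw]] := hvP (org e).
  apply: R_fun (hvP (ter e)); exists (p ++ [:: e]); split.
    by apply/walk_cat; exists (org e).
  rewrite map_cat; apply/lift_end_cat; exists (hv (org e)); split=> //.
  by exists [:: he e]; rewrite /= oe fe1.
have he_inv e : he (einv e) = einv (he e).
  have [oe fe1] := heP e; have [oe' fe1'] := heP (einv e).
  apply: covering_edge_inj; last by rewrite fe1' !fe_einv fe1.
  by rewrite oe' -[org (einv (he e))]/(ter (he e)) he_ter.
have hs_side s : side (hs s) = he (side s).
  have [os fs1] := hsP s; have [oe fe1] := heP (side s).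
  apply: covering_edge_inj; first by rewrite os oe.
  by rewrite -fs_side fs1 fs_side fe1.
have hs_rot s : hs (rot s) = rot (hs s).
  apply: covering_square_inj; last by rewrite fs_rot (hsP _).2 (hsP _).2 fs_rot.
  by rewrite (hsP _).1 !side_rot hs_side he_ter.
have hs_flip s : hs (flip s) = flip (hs s).
  apply: covering_square_inj.
    by rewrite (hsP _).1 !side_flip hs_side -he_inv (heP _).1.
  by rewrite fs_flip (hsP _).2 (hsP _).2 fs_flip.
exists (Morphism (fun e => (heP e).1) he_inv hs_side hs_rot hs_flip).
split=> // [|e|s]; [|exact: (heP e).2|exact: (hsP s).2].
by apply: R_fun (hvP u0) _; exists [::]; split=> //; exists [::].
Qed.

End Lifting.

(** A self-map over [f] that fixes one vertex is the identity: along a walk from [u0], edges with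
    the same origin and the same image under [f] agree. *)
Lemma lifts_inverse (U P K : square_complex) (f : morphism U K)
    (h : morphism U P) (k : morphism P U) (u0 : vertex U) :
  covering f -> connected U ->
  fv k (fv h u0) = u0 ->
  (forall e, fe f (fe k (fe h e)) = fe f e) ->
  (forall s, fs f (fs k (fs h s)) = fs f s) ->
  [/\ cancel (fv h) (fv k), cancel (fe h) (fe k) & cancel (fs h) (fs k)].
Proof.
move=> f_cov [_ U_conn] h0 hE hS.
have vK : cancel (fv h) (fv k).
  move=> u; have [p hp] := U_conn u0 u.
  elim: p u0 h0 hp => [|e p IHp] v /=; first by move=> + <-.
  move=> hv [oe hp]; apply: IHp hp.
  rewrite -!fe_ter; congr ter; apply: (covering_edge_inj f_cov) => //.
  by rewrite !fe_org oe.
split=> // [e|s]; first by apply: (covering_edge_inj f_cov); rewrite ?fe_org.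
by apply: (covering_square_inj f_cov); rewrite ?fs_side ?fe_org.
Qed.

(** The unique square at the image corner is lifted to the origin of [e]; a covering is injective on
    the squares starting at one vertex. *)
Lemma covering_VHT_total (U K : VH_complex) (f : morphism U K) :
  covering f -> preserves_VH f -> VHT_complex K -> VHT_complex U.
Proof.
move=> f_cov f_VH /VHT_complexP hK; apply/VHT_complexP => e g he hg eg.
have [|||s' [[se sg] uniq_s]] := hK (fe f e) (fe f g); rewrite ?f_VH //.
  by rewrite !fe_org eg.
have [_ _ fs_lift] := f_cov.
have [|s [[os fs_s] _]] := fs_lift (org e) s'; first by rewrite se fe_org.
exists s; split=> [|t [te tg]].
  split; apply: (covering_edge_inj f_cov); rewrite ?org_side_rot_flip ?os //.
    by rewrite -fs_side fs_s.
  by rewrite -fs_side fs_rot fs_flip fs_s.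
apply: (covering_square_inj f_cov); rewrite ?os ?te //.
by rewrite fs_s; apply: uniq_s; rewrite -fs_flip -fs_rot !fs_side te tg.
Qed.

(** Each covering map lifts through the other with matching base points; both composites fix a base
    point, hence are identities. *)
Lemma universal_covering_unique (U P K : VH_complex) (f : morphism U K)
    (g : morphism P K) :
  universal_covering f -> universal_covering g -> VH_isomorphic U P.
Proof.
move=> [f_cov f_VH U_sc] [g_cov g_VH P_sc].
have [[[u0] _] _] := U_sc; have [g_surj _ _] := g_cov.
have [v0 hv0] := g_surj (fv f u0).
have [h [h0 hV hE hS]] := lift_exists g_cov U_sc hv0.
have [k [k0 kV kE kS]] := lift_exists f_cov P_sc (esym hv0).
have [||||hvK heK hsK] := lifts_inverse (h := h) (k := k) (u0 := u0) f_cov _.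
- by case: U_sc.
- by rewrite h0.
- by move=> e; rewrite kE.
- by move=> s; rewrite kS.
have [||||kvK keK ksK] := lifts_inverse (h := k) (k := h) (u0 := v0) g_cov _.
- by case: P_sc.
- by rewrite k0.
- by move=> e; rewrite hE.
- by move=> s; rewrite hS.
exists h; split; [|exact: Bijective hvK kvK|exact: Bijective heK keK|].
  by move=> e; rewrite -g_VH hE f_VH.
exact: Bijective hsK ksK.
Qed.

(** * Products of trees are simply connected *)

Lemma homotopic_cat (K : square_complex) (u v w x : vertex K) p q q' r :
  walk u p v -> walk w r x -> homotopic v w q q' ->
  homotopic u x (p ++ q ++ r) (p ++ q' ++ r).
Proof.
move=> hp hr; elim=> [{}q {}q' hqq'|{}q|{}q {}q' _ IH|{}q q1 {}q' _ IH1 _ IH2].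
- have wrap s : walk v s w -> walk u (p ++ s ++ r) x.
    move=> hs; apply/walk_cat; exists v; split=> //.
    by apply/walk_cat; exists w.
  apply: rst_step; case: hqq' => [p1 e p2|p1 s p2] /wrap h1 /wrap h2.
    rewrite -!catA !(catA p); rewrite -!catA !(catA p) in h1 h2.
    exact: Backtrack h1 h2.
  rewrite -!catA !(catA p); rewrite -!catA !(catA p) in h1 h2.
  exact: AroundSquare h1 h2.
- exact: rst_refl.
- exact: rst_sym IH.
- exact: rst_trans IH1 IH2.
Qed.

(** A nonempty loop in a tree has a backtrack to delete; induction on length. The maps [iv] and [ie]
    make this applicable to the slices of a product. *)
Lemma tree_loop_homotopic (T : graph) (K : square_complex)
    (iv : vertex T -> vertex K) (ie : edge T -> edge K) :
  (forall e, org (ie e) = iv (org e)) ->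
  (forall e, ie (einv e) = einv (ie e)) ->
  tree T ->
  forall v p, walk v p v -> homotopic (iv v) (iv v) (map ie p) [::].
Proof.
move=> ie_org ie_inv [_ T_acyclic] v p.
have ie_walk q w : walk w q v -> walk (iv w) (map ie q) (iv v).
  elim: q w => [|e q IHq] w /= => [->//|[<- /IHq hq]].
  by rewrite /ter -ie_inv !ie_org.
have [n] := ubnP (size p); elim: n p => // n IHn p le_n hp.
have [p_red|] := classic (reduced p).
  by rewrite (T_acyclic v p hp p_red); apply: rst_refl.
move=> /not_all_ex_not [p1 /not_all_ex_not [e /not_all_ex_not [p2 /NNPP pE]]].
have hp12 : walk v (p1 ++ p2) v.
  move: hp; rewrite pE => /walk_cat [y [h1 /= [oe [_ h2]]]].
  by apply/walk_cat; exists y; split=> //; rewrite -oe -ter_einv.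
apply: (rst_trans _ _ _ (map ie (p1 ++ p2))).
  apply: rst_step; have := ie_walk _ _ hp; rewrite pE !map_cat /= ie_inv => hp'.
  apply: Backtrack hp'; rewrite -map_cat; exact: ie_walk.
apply: IHn hp12; rewrite pE !size_cat /= in le_n.
by rewrite size_cat; rewrite !addnS ltnS in le_n; apply: ltnW.
Qed.

Section ProductSimplyConnected.
Variables G H : graph.
Let K := product G H.
Implicit Types (v : vertex G) (w : vertex H) (e : edge G) (f : edge H).

Let hor w e : edge K := inl (e, w).
Let ver v f : edge K := inr (v, f).

Lemma hor_walk v p v' w :
  walk v p v' -> @walk K (v, w) (map (hor w) p) (v', w).
Proof. by elim: p v => [|e p IHp] v /= => [->|[<- /IHp]]. Qed.

Lemma ver_walk w p w' v :
  walk w p w' -> @walk K (v, w) (map (ver v) p) (v, w').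
Proof. by elim: p w => [|f p IHp] w /= => [->|[<- /IHp]]. Qed.

Lemma swap_homotopic e f :
  @homotopic K (org e, org f) (ter e, ter f)
    [:: ver (org e) f; hor (ter f) e] [:: hor (org f) e; ver (ter e) f].
Proof.
pose s : dsquare K := inl (e, f).
pose h := hor (ter f) e.
(* The boundary of [s] is inserted in front; its last two edges then cancel against the two edges of
   the original path. *)
apply: (rst_trans _ _ _ (boundary s ++ [:: ver (org e) f; h])).
  apply/rst_sym/rst_step/(AroundSquare (p1 := [::])) => //.
  by rewrite /= /ter /= !einvK.
have -> : boundary s ++ [:: ver (org e) f; h] =
    [:: hor (org f) e; ver (ter e) f; einv h] ++
    [:: einv (ver (org e) f); einv (einv (ver (org e) f))] ++ [:: h].
  by rewrite /= !einvK.
apply: (rst_trans _ _ _ ([:: hor (org f) e; ver (ter e) f] ++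
    [:: einv h; einv (einv h)] ++ [::])).
  rewrite [einv (einv h)]einvK; apply: rst_step.
  apply: (@Backtrack K _ _ [:: hor (org f) e; ver (ter e) f; einv h]
    (einv (ver (org e) f)) [:: h]); by rewrite /= /ter /= !einvK.
by apply/rst_step/Backtrack => //=; rewrite /ter /= !einvK.
Qed.

Lemma slide_homotopic v p v' f : walk v p v' ->
  @homotopic K (v, org f) (v', ter f)
    (ver v f :: map (hor (ter f)) p) (rcons (map (hor (org f)) p) (ver v' f)).
Proof.
elim: p v => [|e p IHp] v /= => [->|[<- hp]]; first exact: rst_refl.
apply: (rst_trans _ _ _
    (hor (org f) e :: ver (ter e) f :: map (hor (ter f)) p)).
  have := homotopic_cat (u := (org e, org f) : vertex K) (p := [::]) erefl
    (hor_walk (ter f) hp) (swap_homotopic e f).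
  by [].
have := homotopic_cat (p := [:: hor (org f) e])
  (u := (org e, org f) : vertex K) (r := [::]) _ erefl (IHp _ hp).
by rewrite !cats0; apply.
Qed.

(** By induction the rest of the path is horizontal, then vertical; a vertical first edge slides
    past the horizontal part, one square at a time. *)
Lemma walk_straighten v w v' w' (p : seq (edge K)) :
  @walk K (v, w) p (v', w') ->
  exists p1 p2, [/\ walk v p1 v', walk w p2 w' &
    @homotopic K (v, w) (v', w') p (map (hor w) p1 ++ map (ver v') p2)].
Proof.
elim: p v w => [|[[e w1]|[v1 f]] p IHp] v w /=.
- by case=> -> ->; exists [::], [::]; split=> //; apply: rst_refl.
- case=> [[<- ->]] /IHp [p1 [p2 [h1 h2 hp]]]; exists (e :: p1), p2; split=> //.
  have := homotopic_cat (p := [:: hor w e])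
    (u := (org e, w) : vertex K) (r := [::]) _ erefl hp.
  by rewrite !cats0; apply.
- case=> [[-> <-]] /IHp [p1 [p2 [h1 h2 hp]]]; exists p1, (f :: p2); split=> //.
  apply: (rst_trans _ _ _
    (ver v f :: map (hor (ter f)) p1 ++ map (ver v') p2)).
    have := homotopic_cat (p := [:: ver v f])
      (u := (v, org f) : vertex K) (r := [::]) _ erefl hp.
    by rewrite !cats0; apply.
  have := homotopic_cat (u := (v, org f) : vertex K) (p := [::]) erefl
    (ver_walk v' h2) (slide_homotopic f h1).
  by rewrite /= cat_rcons.
Qed.

(** A straightened loop is a loop in a horizontal slice followed by one in a vertical slice, and
    both slices are trees. *)
Lemma product_simply_connected : tree G -> tree H -> simply_connected K.
Proof.
move=> G_tree H_tree; split.
  have [[v0] G_conn] := proj1 G_tree; have [[w0] H_conn] := proj1 H_tree.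
  split=> [|[v w] [v' w']]; first by exists; exact: (v0, w0).
  have [p hp] := G_conn v v'; have [q hq] := H_conn w w'.
  exists (map (hor w) p ++ map (ver v') q); apply/walk_cat; exists (v', w).
  by split; [apply: hor_walk|apply: ver_walk].
case=> v w p /walk_straighten [p1 [p2 [h1 h2 hp]]].
apply: rst_trans hp _; apply: (rst_trans _ _ _ (map (ver v) p2)).
  have := homotopic_cat (K := K) (u := (v, w)) (p := [::]) erefl
    (ver_walk v h2) (tree_loop_homotopic (K := K) (iv := fun v => (v, w))
      (ie := hor w) (fun=> erefl) (fun=> erefl) G_tree h1).
  by [].
exact: (tree_loop_homotopic (K := K) (iv := fun w => (v, w))
  (ie := ver v) (fun=> erefl) (fun=> erefl) H_tree h2).
Qed.

End ProductSimplyConnected.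

(** * The Cayley tree of a free group *)

Section FreeTree.
Variable S : eqType.

Definition letter : Type := S * bool.

Definition linv (a : letter) : letter := (a.1, ~~ a.2).

Lemma linvK : involutive linv.
Proof. by case=> x b; rewrite /linv /= negbK. Qed.

Lemma linv_neq a : linv a <> a.
Proof. by case: a => x [] []. Qed.

(* The last letter of a word comes first. *)
Definition free_word := {w : seq letter | sorted (fun a b => b != linv a) w}.

(** Right multiplication by [a] in the free group; as words are stored backwards, only the head can
    cancel. *)
Definition rmul (w : seq letter) (a : letter) : seq letter :=
  if w is b :: w' then if b == linv a then w' else a :: w else [:: a].

Variant rmul_spec (w : seq letter) (a : letter) : seq letter -> Prop :=
| RmulCancel w' of w = linv a :: w' : rmul_spec w a w'
| RmulGrow : rmul_spec w a (a :: w).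

Lemma rmulP w a : rmul_spec w a (rmul w a).
Proof.
case: w => [|b w] /=; first exact: RmulGrow.
by case: eqP => [->|_]; [apply: RmulCancel|apply: RmulGrow].
Qed.

Lemma rmul_reduced (w : free_word) a :
  sorted (fun a b => b != linv a) (rmul (val w) a).
Proof.
case: w => -[|b w] //= hw; case: eqP => [_|/eqP hb].
  exact: path_sorted hw.
by rewrite /= hb.
Qed.

Definition free_mul (w : free_word) (a : letter) : free_word :=
  exist _ (rmul (val w) a) (rmul_reduced w a).

Lemma free_mulK w a : free_mul (free_mul w a) (linv a) = w.
Proof.
apply: val_inj; case: w => -[|b w] /= hw; first by rewrite linvK eqxx.
case: eqP => [hb|_] /=; last by rewrite linvK eqxx.
case: w hw => [|c w] /=; first by rewrite hb.
(* Here [a] has cancelled [b]; the next letter [c] is not [a] because the word was reduced, so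
   multiplying by [linv a] puts [b] back. *)
by case/andP=> hc _; rewrite hb linvK in hc *; rewrite (negbTE hc).
Qed.

Fact free_einvK (e : free_word * letter) :
  let einv e := (free_mul e.1 e.2, linv e.2) in einv (einv e) = e.
Proof. by case: e => w a /=; rewrite free_mulK linvK. Qed.

Fact free_einv_neq (e : free_word * letter) :
  (free_mul e.1 e.2, linv e.2) <> e.
Proof. by case: e => w a /(congr1 snd); apply: linv_neq. Qed.

Definition free_tree : graph := Graph fst free_einvK free_einv_neq.

Lemma free_tree_connected : connected free_tree.
Proof.
pose nil : free_word := exist _ [::] isT.
have from_nil : forall w : free_word, exists p, @walk free_tree nil p w.
  case; elim=> [|a w IHw] hw; first by exists [::]; apply: val_inj.
  have [p hp] := IHw (path_sorted hw).
  exists (rcons p (exist _ w (path_sorted hw), a)); rewrite -cats1.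
  apply/walk_cat; exists (exist _ w (path_sorted hw)); split=> //.
  split=> //; apply: val_inj => /=.
  by case: w hw {IHw p hp} => [|b w] //= /andP[/negbTE -> _].
split=> [|v w]; first by exists; exact: nil.
have [p hp] := from_nil v; have [q hq] := from_nil w.
exists (rev [seq einv e | e <- p] ++ q); apply/walk_cat; exists nil.
by split=> //; apply: walk_rev.
Qed.

(* A reduced walk first cancels letters of its origin, then appends letters. *)
Lemma reduced_walk_shape (p : seq (edge free_tree)) (v w : free_word) :
  @walk free_tree v p w -> reduced p ->
  exists l1 l2 z, [/\ map snd p = l1 ++ l2, val v = map linv l1 ++ z &
    val w = rev l2 ++ z].
Proof.
elim: p v => [|[v' a] p IHp] v /=.
  by move=> <- _; exists [::], [::], (val v).
case=> -> hp p_red.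
have [|l1 [l2 [z [pE vE wE]]]] := IHp _ hp.
  by move=> p1 e p2 pE; apply: (p_red ((v, a) :: p1) e p2); rewrite pE.
move: vE; rewrite /= /ter /=; case: rmulP => [u ->|] uE.
  by exists (a :: l1), l2, z; rewrite /= pE uE.
case: l1 pE uE => [|c l1] /= pE.
  move=> zE; exists [::], (a :: l2), (val v).
  by rewrite /= pE wE -zE rev_cons cat_rcons.
(* If [a] was appended and the rest of the walk began by cancelling it, the next letter would be
   [linv a], a backtrack. *)
case=> aE _; case: p pE hp p_red {IHp} => [|[u d] p] //= [dE _] [uE _].
case/(_ [::] (v, a) p); congr [:: _, _ & _].
by rewrite uE dE aE /= linvK.
Qed.

(** For a loop, the inverses of the cancelled letters [l1] are the appended letters [l2] in reverse
    order. So if [l1] is nonempty, its last letter is followed in [p] by its inverse, a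
    backtrack. *)
Lemma free_tree_tree : tree free_tree.
Proof.
split=> [|v p hp p_red]; first exact: free_tree_connected.
have [l1 [l2 [z [pE vE wE]]]] := reduced_walk_shape hp p_red.
have l12 : map linv l1 = rev l2.
  have : size (map linv l1 ++ z) = size (rev l2 ++ z) by rewrite -vE -wE.
  rewrite !size_cat => /addIn hsize; move: vE; rewrite wE => /eqP.
  by rewrite eqseq_cat // => /andP[/eqP ->].
case/lastP: l1 pE l12 {vE} => [|l1 a] pE.
  move/(congr1 size); rewrite size_rev.
  by case: l2 pE {wE} => //; case: p {hp p_red}.
rewrite map_rcons => /(congr1 rev); rewrite rev_rcons revK => l2E.
(* With its last letter [a] split off, [size l1] is the index of that letter in [p]. *)
case: (p_red (take (size l1) p) (nth (v, a) p (size l1)) (drop (size l1).+2 p)).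
have hsize : (size l1).+1 < size p.
  have := congr1 size pE; rewrite size_map => ->.
  by rewrite -l2E size_cat size_rcons /= addnS ltnS leq_addr.
rewrite -{1}(cat_take_drop (size l1) p) (drop_nth (v, a)) 1?ltnW //.
rewrite (drop_nth (v, a)) //; congr (_ ++ _ :: _ :: _).
move: hp; rewrite -{1}(cat_take_drop (size l1) p) (drop_nth (v, a)) 1?ltnW //.
rewrite (drop_nth (v, a)) // => /walk_cat [x [_ /= [_ [oE _]]]].
have nthE i : i < size p -> (nth (v, a) p i).2 = nth a (rcons l1 a ++ l2) i.
  by move=> hi; have := congr1 (nth a ^~ i) pE; rewrite (nth_map (v, a)).
have := nthE _ hsize; have := nthE _ (ltnW hsize).
rewrite cat_rcons !nth_cat ltnn subnn /= ltnNge leqnSn /= subSnn /= -l2E /=.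
move: oE; case: (nth _ p _.+1) => u b /= -> aE bE; rewrite /= /ter /=.
by congr (_, _); rewrite bE aE.
Qed.

End FreeTree.

(** * Bi-reversibility and the corners of the squares *)

Section Corners.
Variable A : automaton.

Lemma Sigma_VHTP : VHT_complex (Sigma A) <->
  forall a b, @corner_unique (Sigma A) (inl a) (inr b).
Proof.
rewrite VHT_complexP; split=> [h a b|h [a|//] [//|b] _ _ _]; last exact: h.
exact: h.
Qed.

(* The horizontal letter and the vertical letter of the square at [p] that meet
   in the corner where they have signs [s] and [t]. *)
Definition corner (s t : bool) (p : alphabet A * state A) :
    alphabet A * state A :=
  (if t then p.1 else out p.1 p.2, if s then p.2 else trans p.1 p.2).

(** Index 0 is the bottom side and 2 the top side. The boundary path runs along the bottom
    positively and along the top negatively, so a flip is needed exactly when [s] and [t] differ. *)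
Definition corner_square (s t : bool) (p : alphabet A * state A) :
    dsquare (Sigma A) :=
  (p.1, p.2, if t then 0%R else 2%:R%R, s != t).

Lemma side_corner_square s t p :
  side (corner_square s t p) = inl ((corner s t p).1, s) /\
  side (rot (flip (corner_square s t p))) = inr ((corner s t p).2, t).
Proof. by case: s t p => [] [] [x q]. Qed.

Lemma corner_square_onto (d : dsquare (Sigma A)) x s q t :
  side d = inl (x, s) -> side (rot (flip d)) = inr (q, t) ->
  exists p, d = corner_square s t p.
Proof.
case: d => [[[y r] i] b] hs ht; exists (y, r); move: hs ht.
case: i => [[|[|[|[|i]]]] hi] //; case: b => //= -[_ <-] [_ <-];
  by congr (_, _, _, _); apply: val_inj.
Qed.

Lemma corner_square_inj s t : injective (corner_square s t).
Proof.
move=> p p' /(congr1 (fun d : sigma_square A => d.1.1)) /=.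
by rewrite -!surjective_pairing.
Qed.

(** The directed squares with signs [s] and [t] at their corner correspond to the pairs in X x Q, so
    unique corners mean that [corner s t] is bijective; on a finite set injectivity suffices. *)
Lemma Sigma_VHT_corner :
  VHT_complex (Sigma A) <-> forall s t, injective (corner s t).
Proof.
rewrite Sigma_VHTP; split=> [h s t p p' pp' | h [x s] [q t]].
  have [se te] := side_corner_square s t p.
  have [se' te'] := side_corner_square s t p'.
  have [d [_ uniq_d]] := h ((corner s t p).1, s) ((corner s t p).2, t).
  apply: (@corner_square_inj s t).
  by rewrite -(uniq_d (corner_square s t p)) // -(uniq_d (corner_square s t p'))
    // pp'.
have [g gK Kg] := injF_bij (h s t).
have [se te] := side_corner_square s t (g (x, q)).
exists (corner_square s t (g (x, q))); split=> [|d [sd td]].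
  by rewrite se te Kg.
have [p pE] := corner_square_onto sd td.
have [] := side_corner_square s t p; rewrite -pE sd td => -[-> ] [->].
by rewrite pE; congr (corner_square _ _ _); apply: gK.
Qed.

(** Three inverses occur among the eight automata. The signs [true false] correspond to that of [A],
    [false true] to that of its dual, and [false false] to that of the dual of its inverse. *)
Lemma bireversible_corner :
  bireversible A <-> forall s t, injective (corner s t).
Proof.
have inv_out (hA : invertible A) x q : @out A (@out (inverse hA) x q) q = x.
  exact: (f_invF (bij_inj (hA q))).
have inv_outK (hA : invertible A) x q : @out (inverse hA) (@out A x q) q = x.
  exact: (invF_f (bij_inj (hA q))).
rewrite /bireversible /inverse_opt /=.
case: invertible_dec => [hA|nA] /=; last first.
  split=> // h; case: nA => q; apply: injF_bij => x y xy.
  by have := h true false (x, q) (y, q); rewrite /corner /= xy => /(_ erefl) [].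
case: (invertible_dec (dual A)) => [hD|nD] /=; last first.
  split=> // h; case: nD => x; apply: injF_bij => q r /= qr.
  by have := h false true (x, q) (x, r); rewrite /corner /= qr => /(_ erefl) [].
case: invertible_dec => [hI|nI] /=; split=> //.
  move=> _ [] [] [x q] [y r] [] //=.
  - by move=> -> ->.
  - by move=> xy qr; rewrite -qr in xy *; rewrite (bij_inj (hA q) xy).
  - by move=> xy qr; rewrite -xy in qr *; rewrite (bij_inj (hD x) qr).
  (* On the common letter [out x q] the inverse automaton moves from [q] and from [r] to the same
     state; invertibility of its dual gives [q = r]. *)
  - move=> xy qr; have e : q = r.
      apply: (bij_inj (hI (out x q))).
      change (@trans A (@out (inverse hA) (out x q) q) q =
              @trans A (@out (inverse hA) (out x q) r) r).
      by rewrite {2}xy !inv_outK.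
    by rewrite -e in xy *; rewrite (bij_inj (hA q) xy).
move=> h; case: nI => x; apply: injF_bij => q r qr.
have := h false false (@out (inverse hA) x q, q)
  (@out (inverse hA) x r, r).
by rewrite /corner !inv_out => /(_ (f_equal (pair x) qr)) [].
Qed.

End Corners.

(** * Labels of the product of the two trees *)

Section Labels.
Variables X Q : eqType.
Variables (phi : letter Q -> letter X -> letter X).
Variables (psi : letter X -> letter Q -> letter Q).
Hypothesis phiK : forall b a, phi (linv b) (phi b a) = a.
Hypothesis psiK : forall a b, psi (linv a) (psi a b) = b.
Hypothesis phi_linv : forall a b, phi (psi a b) (linv a) = linv (phi b a).
Hypothesis psi_linv : forall a b, psi (phi b a) (linv b) = linv (psi a b).

(** A strip of squares over [w]: [foldr phi a w'] is the letter that [a] becomes after climbing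
    [w'], and the result labels the far side. *)
Fixpoint across (a : letter X) (w : seq (letter Q)) : seq (letter Q) :=
  if w is b :: w' then psi (foldr phi a w') b :: across a w' else [::].

(* The vertical word [w], read at the end of the horizontal word [v]. *)
Definition transport (v : seq (letter X)) w := foldr across w v.

Definition labelh v w a := foldr phi a (transport v w).
(** Transport preserves length, so the default of [head] is never reached. *)
Definition labelv v w b := head b (transport v (b :: w)).

Lemma transport_cons v b w :
  transport v (b :: w) = labelv v w b :: transport v w.
Proof. by rewrite /labelv; elim: v => //= a v ->. Qed.

Lemma labelh_cons v b w a :
  labelh v (b :: w) a = phi (labelv v w b) (labelh v w a).
Proof. by rewrite /labelh transport_cons. Qed.

Lemma labelv_cons a v w b :
  labelv (a :: v) w b = psi (labelh v w a) (labelv v w b).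
Proof. by rewrite {1}/labelv /= transport_cons. Qed.

Lemma labelh_nil v a : labelh v [::] a = a.
Proof.
rewrite /labelh; suff -> : transport v [::] = [::] by [].
by elim: v => //= c v ->.
Qed.

Lemma labelh_linv a v w : labelh (a :: v) w (linv a) = linv (labelh v w a).
Proof.
elim: w => [|b w IHw]; first by rewrite !labelh_nil.
by rewrite !labelh_cons labelv_cons IHw phi_linv.
Qed.

Lemma labelv_linv v b w : labelv v (b :: w) (linv b) = linv (labelv v w b).
Proof.
by elim: v => // a v IHv; rewrite !labelv_cons labelh_cons IHv psi_linv.
Qed.

(** In the cancelling case [v] is [linv a :: v'], and the edge along [a] is the reverse of the one
    from [v'] along [linv a], which is the growing case. *)
Lemma labelh_rmul_linv v w a :
  labelh (rmul v a) w (linv a) = linv (labelh v w a).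
Proof.
case: rmulP => [v' ->|]; last exact: labelh_linv.
by have := labelh_linv (linv a) v' w; rewrite linvK => ->; rewrite linvK.
Qed.

Lemma labelv_rmul v w a b :
  labelv (rmul v a) w b = psi (labelh v w a) (labelv v w b).
Proof.
case: rmulP => [v' ->|]; last exact: labelv_cons.
have := labelh_linv (linv a) v' w; rewrite linvK labelv_cons => ->.
by rewrite psiK.
Qed.

Lemma labelv_rmul_linv v w b :
  labelv v (rmul w b) (linv b) = linv (labelv v w b).
Proof.
case: rmulP => [w' ->|]; last exact: labelv_linv.
by have := labelv_linv v (linv b) w'; rewrite linvK => ->; rewrite linvK.
Qed.

Lemma labelh_rmul v w a b :
  labelh v (rmul w b) a = phi (labelv v w b) (labelh v w a).
Proof.
case: rmulP => [w' ->|]; last exact: labelh_cons.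
have := labelv_linv v (linv b) w'; rewrite linvK labelh_cons => ->.
by rewrite phiK.
Qed.

Lemma labelh_bij v w : bijective (labelh v w).
Proof.
elim: w => [|b w IHw].
  by apply: (eq_bij (f := id)) => [|a]; [exists id | rewrite labelh_nil].
have phi_bij : bijective (phi (labelv v w b)).
  exists (phi (linv (labelv v w b))) => a; first exact: phiK.
  by rewrite -{1}(linvK (labelv v w b)) phiK.
by apply: (eq_bij (bij_comp phi_bij IHw)) => a; rewrite labelh_cons.
Qed.

Lemma labelv_bij v w : bijective (labelv v w).
Proof.
elim: v => [|a v IHv]; first by exists id.
have psi_bij : bijective (psi (labelh v w a)).
  exists (psi (linv (labelh v w a))) => b; first exact: psiK.
  by rewrite -{1}(linvK (labelh v w a)) psiK.
by apply: (eq_bij (bij_comp psi_bij IHv)) => b; rewrite labelv_cons.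
Qed.

End Labels.

(** * The covering of the complex of an automaton by a product of trees *)

Section DihedralRelations.
Variable K : square_complex.

Lemma rot_flip_involutive (s : dsquare K) : rot (flip (rot (flip s))) = s.
Proof. by rewrite rot_flip_rot flipK. Qed.

Lemma flip_rot_flip (s : dsquare K) : flip (rot (flip s)) = rot (rot (rot s)).
Proof.
rewrite -[LHS](rot4 (flip (rot (flip s)))) !iterS /=.
by rewrite rot_flip_involutive.
Qed.

Lemma rot2_flip (s : dsquare K) : rot (rot (flip s)) = flip (rot (rot s)).
Proof. by rewrite -{1}(rot4 s) /= rot_flip_rot rot_flip_rot. Qed.

End DihedralRelations.

(** The corner of [s] is a link edge joining these two sides. *)
Lemma horizontal_corner (K : VH_complex) (s : dsquare K) :
  horizontal (side (rot (flip s))) = ~~ horizontal (side s).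
Proof.
pose c : link_edge (org (side s)) := exist _ s erefl.
have /(congr1 negb) := horizontal_link c.
by rewrite negbK => /esym.
Qed.

Section Covering.
Variable A : automaton.
Let K := Sigma A.
Variables (sq : letter (alphabet A) -> letter (state A) -> dsquare K).
Variables (phi : letter (state A) -> letter (alphabet A) ->
                 letter (alphabet A)).
Variables (psi : letter (alphabet A) -> letter (state A) -> letter (state A)).
Hypothesis side_sq : forall a b, side (sq a b) = inl a.
Hypothesis corner_sq : forall a b, side (rot (flip (sq a b))) = inr b.
Hypothesis sq_unique : forall (s : dsquare K) a b,
  side s = inl a -> side (rot (flip s)) = inr b -> s = sq a b.
Hypothesis side_rot_sq : forall a b, side (rot (sq a b)) = inr (psi a b).
Hypothesis side_rot2_sq :
  forall a b, einv (side (rot (rot (sq a b)))) = inl (phi b a).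

Lemma einv_inl a : @einv K (inl a) = inl (linv a).
Proof. by case: a. Qed.

Lemma einv_inr b : @einv K (inr b) = inr (linv b).
Proof. by case: b. Qed.

(** A square is determined by its two sides at the corner, so the dihedral relations become the
    identities on [phi] and [psi] that the labelling requires. *)
Lemma flip_sq a b : flip (sq a b) = sq (linv a) (psi a b).
Proof.
by apply: sq_unique; rewrite ?flipK // side_flip side_sq einv_inl.
Qed.

Lemma flip_rot2_sq a b : flip (rot (rot (sq a b))) = sq (phi b a) (linv b).
Proof.
apply: sq_unique; first by rewrite side_flip side_rot2_sq.
by rewrite flipK -flip_rot_flip side_flip corner_sq einv_inr.
Qed.

Lemma sq_psiK a b : psi (linv a) (psi a b) = b.
Proof.
apply: (@inr_inj (letter (alphabet A))).
by rewrite -side_rot_sq -flip_sq corner_sq.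
Qed.

Lemma sq_phi_linv a b : phi (psi a b) (linv a) = linv (phi b a).
Proof.
apply: (@inl_inj _ (letter (state A))).
by rewrite -side_rot2_sq -flip_sq rot2_flip side_flip side_rot2_sq einv_inl.
Qed.

Lemma sq_psi_linv a b : psi (phi b a) (linv b) = linv (psi a b).
Proof.
apply: (@inr_inj (letter (alphabet A))).
rewrite -side_rot_sq -flip_rot2_sq rot_flip_rot side_flip side_rot_sq.
exact: einv_inr.
Qed.

Lemma sq_phiK b a : phi (linv b) (phi b a) = a.
Proof.
apply: (@inl_inj _ (letter (state A))).
rewrite -side_rot2_sq -flip_rot2_sq rot2_flip side_flip einvK.
by rewrite -[rot (rot (rot _))]/(iter 4 (@rot K) _) rot4 side_sq.
Qed.

Let T1 := free_tree (alphabet A).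
Let T2 := free_tree (state A).
Let P := product T1 T2.

Let lh (v : vertex T1) (w : vertex T2) := labelh phi psi (val v) (val w).
Let lv (v : vertex T1) (w : vertex T2) := labelv phi psi (val v) (val w).

Definition label_edge (d : edge P) : edge K :=
  match d with
  | inl ((v, a), w) => inl (lh v w a)
  | inr (v, (w, b)) => inr (lv v w b)
  end.

(** A square starting vertically is the horizontal one with the same corner, reversed. *)
Definition label_square (s : dsquare P) : dsquare K :=
  match s with
  | inl ((v, a), (w, b)) => sq (lh v w a) (lv v w b)
  | inr ((v, a), (w, b)) => rot (flip (sq (lh v w a) (lv v w b)))
  end.

Fact label_einv d : label_edge (einv d) = einv (label_edge d).
Proof.
case: d => [[[v a] w]|[v [w b]]]; rewrite /label_edge ?einv_inl ?einv_inr /=.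
  by rewrite /lh labelh_rmul_linv //; apply: sq_phi_linv.
by rewrite /lv labelv_rmul_linv //; apply: sq_psi_linv.
Qed.

Fact label_side s : side (label_square s) = label_edge (side s).
Proof.
by case: s => -[[v a] [w b]]; [apply: side_sq|apply: corner_sq].
Qed.

Fact label_hinv v a w b :
  sq (lh (free_mul v a) w (linv a)) (lv (free_mul v a) w b) =
  flip (sq (lh v w a) (lv v w b)).
Proof.
rewrite flip_sq /lh /lv /= labelh_rmul_linv ?labelv_rmul //.
- exact: sq_psiK.
- exact: sq_phi_linv.
- exact: sq_phi_linv.
Qed.

Fact label_vinv v a w b :
  sq (lh v (free_mul w b) a) (lv v (free_mul w b) (linv b)) =
  flip (rot (rot (sq (lh v w a) (lv v w b)))).
Proof.
rewrite flip_rot2_sq /lh /lv /= labelv_rmul_linv ?labelh_rmul //.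
- exact: sq_phiK.
- exact: sq_psi_linv.
- exact: sq_psi_linv.
Qed.

Fact label_rot s : label_square (rot s) = rot (label_square s).
Proof.
case: s => -[[v a] [w b]].
  by rewrite [LHS](f_equal (fun s => rot (flip s)) (label_hinv v a w b)) flipK.
by rewrite [LHS](label_vinv v a w b) -rot2_flip.
Qed.

Fact label_flip s : label_square (flip s) = flip (label_square s).
Proof.
case: s => -[[v a] [w b]]; first exact: label_hinv.
rewrite [LHS](f_equal (fun s => rot (flip s)) (label_vinv v a w b)).
by rewrite flipK -flip_rot_flip.
Qed.

Definition label : morphism P K :=
  @Morphism P K (fun=> tt) label_edge label_square
    (fun=> erefl) label_einv label_side label_rot label_flip.

Lemma lh_bij v w : bijective (lh v w).
Proof. by apply: labelh_bij; apply: sq_phiK. Qed.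

Lemma lv_bij v w : bijective (lv v w).
Proof. by apply: labelv_bij; apply: sq_psiK. Qed.

Lemma sq_inj a b a' b' : sq a b = sq a' b' -> a = a' /\ b = b'.
Proof.
move=> e; have := corner_sq a b; have := side_sq a b.
by rewrite e side_sq corner_sq => -[->] [->].
Qed.

Lemma sq_surj (s : dsquare K) :
  (exists a b, s = sq a b) \/ (exists a b, s = rot (flip (sq a b))).
Proof.
have := horizontal_corner s.
case hs: (side s) => [a|b]; case ht: (side (rot (flip s))) => [a'|b'] // _.
  by left; exists a, b'; apply: sq_unique.
right; exists a', b; rewrite -(rot_flip_involutive s); congr (rot (flip _)).
by apply: sq_unique; rewrite ?rot_flip_involutive.
Qed.

(** At [(v, w)] the labels of horizontal and of vertical edges are bijections, and squares there
    correspond to pairs of such edges together with a choice of the starting one. *)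
Lemma label_covering : covering label.
Proof.
split=> [[]|[v w] e' _|[v w] s' _].
- by exists (exist _ [::] isT, exist _ [::] isT).
- have [gh ghK Kgh] := lh_bij v w; have [gv gvK Kgv] := lv_bij v w.
  case: e' => [a'|b'].
    exists (inl ((v, gh a'), w)); split; first by rewrite /= Kgh.
    by case=> [[[v1 a] w1]|[v1 [w1 b]]] [[-> ->]] //= [<-]; rewrite ghK.
  exists (inr (v, (w, gv b'))); split; first by rewrite /= Kgv.
  by case=> [[[v1 a] w1]|[v1 [w1 b]]] [[-> ->]] //= [<-]; rewrite gvK.
have [gh ghK Kgh] := lh_bij v w; have [gv gvK Kgv] := lv_bij v w.
have sq_neq a b a' b' : sq a b <> rot (flip (sq a' b')).
  by move=> e; have := side_sq a b; rewrite e corner_sq.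
have [[a [b ->]]|[a [b ->]]] := sq_surj s'.
  exists (inl ((v, gh a), (w, gv b))); split; first by rewrite /= Kgh Kgv.
  case=> -[[v1 a1] [w1 b1]] [[-> ->]] /=; last by move/esym/sq_neq.
  by case/sq_inj=> <- <-; rewrite ghK gvK.
exists (inr ((v, gh a), (w, gv b))); split; first by rewrite /= Kgh Kgv.
case=> -[[v1 a1] [w1 b1]] [[-> ->]] /=; first by move/sq_neq.
move/(congr1 (fun s : dsquare K => rot (flip s))).
by rewrite !(@rot_flip_involutive K) => /sq_inj[] <- <-; rewrite ghK gvK.
Qed.

Lemma label_universal_covering : universal_covering label.
Proof.
split; first exact: label_covering.
  by case=> [[[v a] w]|[v [w b]]].
by apply: product_simply_connected; apply: free_tree_tree.
Qed.

End Covering.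

(** * The universal covering of [Sigma A] and the two equivalences *)

Lemma VHT_Sigma_universal_covering (A : automaton) : VHT_complex (Sigma A) ->
  exists f : morphism (product (free_tree (alphabet A)) (free_tree (state A)))
               (Sigma A),
    universal_covering f.
Proof.
move=> /Sigma_VHTP h; pose K := Sigma A.
(* Chosen together: the unique square at the corner of [a] and [b], the side opposite to [b], and
   the side opposite to [a], reversed so as to run parallel to [a]. *)
have data_ex (c : letter (alphabet A) * letter (state A)) :
    exists t : dsquare K * letter (state A) * letter (alphabet A),
      [/\ side t.1.1 = inl c.1, side (rot (flip t.1.1)) = inr c.2,
        forall s : dsquare K, side s = inl c.1 ->
          side (rot (flip s)) = inr c.2 -> s = t.1.1,
        side (rot t.1.1) = inr t.1.2 &
        einv (side (rot (rot t.1.1))) = inl t.2].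
  case: c => a b; have [s [[sa sb] uniq_s]] := h a b.
  have [b' rE] : exists b', side (rot s) = inr b'.
    have := horizontal_corner (flip s).
    rewrite flipK side_flip horizontal_einv sa.
    by case: (side (rot s)) => [//|b'] _; exists b'.
  have [a' r2E] : exists a', einv (side (rot (rot s))) = inl a'.
    have := horizontal_corner (rot (rot s)).
    rewrite rot_flip_rot side_flip horizontal_einv rE.
    rewrite -(horizontal_einv (side (rot (rot s)))).
    by case: (einv (side (rot (rot s)))) => [a'|//] _; exists a'.
  exists (s, b', a'); split=> // t ta tb.
  by apply/esym/uniq_s.
have [F FP] := functional_choice _ data_ex.
pose sq a b := (F (a, b)).1.1; pose psi a b := (F (a, b)).1.2.
pose phi b a := (F (a, b)).2.
have side_sq a b : side (sq a b) = inl a by case: (FP (a, b)).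
have corner_sq a b : side (rot (flip (sq a b))) = inr b by case: (FP (a, b)).
have sq_unique (s : dsquare K) a b :
    side s = inl a -> side (rot (flip s)) = inr b -> s = sq a b.
  by case: (FP (a, b)) => _ _ + _ _; apply.
have side_rot_sq a b : side (rot (sq a b)) = inr (psi a b).
  by case: (FP (a, b)).
have side_rot2_sq a b : einv (side (rot (rot (sq a b)))) = inl (phi b a).
  by case: (FP (a, b)).
eexists; exact: (label_universal_covering side_sq corner_sq sq_unique
  side_rot_sq side_rot2_sq).
Qed.

Theorem proposition2p6 (A : automaton) :
  (bireversible A <-> VHT_complex (Sigma A)) /\
  (VHT_complex (Sigma A) <->
     universal_cover_is_product_of_trees (Sigma A)).
Proof.
split; first by rewrite bireversible_corner Sigma_VHT_corner.
split=> [/VHT_Sigma_universal_covering [f f_univ]|].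
  split=> [|U g g_univ]; first by exists _, f.
  exists (free_tree (alphabet A)), (free_tree (state A)).
  split; [exact: free_tree_tree..|].
  exact: universal_covering_unique g_univ f_univ.
(* Complete bipartite links pass from the product up to [U] along the isomorphism, then down to
   [Sigma A] along the covering. *)
case=> -[U [f f_univ]] /(_ U f f_univ) [T1 [T2 [_ _ [h [h_VH hv he hs]]]]].
have [f_cov f_VH _] := f_univ.
apply: (covering_VHT_base f_cov f_VH).
apply: (covering_VHT_total (bijective_covering hv he hs) h_VH).
exact: product_VHT.
Qed.
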